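(* Let $a > b > 0$ be real numbers and let $A$ be a complex $n \times n$ matrix whose spectrum belongs to $$\mathcal{E}_i = \left\{\lambda \in \mathbb{C} : \frac{(\mathrm{Re}\,\lambda)^2}{a^2} + \frac{(\mathrm{Im}\,\lambda)^2}{b^2} < 1 \right\}.$$ Let $H = H^* > 0$ be a solution to $$H - \left(\frac{1}{2a^2}+\frac{1}{2b^2}\right) A^*HA - \left(\frac{1}{4a^2}-\frac{1}{4b^2}\right)\left(HA^2+(A^* )^2H\right) = I.$$ If $B$ is a complex $n \times n$ matrix such that $$\left(\frac{1}{2a^2}+\frac{1}{2b^2}\right) \left(B^*HA + A^*HB + B^*HB\right) + \left(\frac{1}{4a^2}-\frac{1}{4b^2}\right)\left(H(AB + BA + B^2) + (AB + BA + B^2)^*H\right) < I,$$ then the spectrum of the matrix $A + B$ also belongs to $\mathcal{E}_i$.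
   Context: $M^*$ denotes the conjugate transpose of $M$, and $I$ is the $n\times n$ identity matrix. For Hermitian matrices $M, N$, $M > 0$ means that $M$ is positive definite and $M < N$ means that $N - M$ is positive definite. *)

(* Defs.v *)
(* R : realType is the field of real numbers and R[i] the field of complex
   numbers over it. *)
From mathcomp Require Export all_boot all_order all_algebra.
From mathcomp Require Export complex reals.

Set Implicit Arguments.
Unset Strict Implicit.
Unset Printing Implicit Defensive.

Export Order.TTheory GRing.Theory Num.Theory.

#[global] Open Scope ring_scope.
#[global] Open Scope complex_scope.
(* M ^t* is the conjugate transpose. *)
#[global] Open Scope sesquilinear_scope.

Definition ellipse_interior (R : realType) (a b : R) : pred R[i] :=
  fun z => complex.Re z ^+ 2 / a ^+ 2 + complex.Im z ^+ 2 / b ^+ 2 < 1.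

(* In R[i], [0 < z] means that z has zero imaginary part and positive real
   part. *)
Definition posdefmx (R : realType) (n : nat) (M : 'M[R[i]]_n) : Prop :=
  M \is hermsymmx /\
  forall x : 'cV[R[i]]_n, x != 0 -> 0 < (x ^t* *m M *m x) 0 0.

(* The strict Loewner order. *)
Definition ltmx_posdef (R : realType) (n : nat) (M N : 'M[R[i]]_n) : Prop :=
  posdefmx (N - M).

(* Main.v *)
(* Write p, q for the two real coefficients, C = A + B, and M' for the
   conjugate transpose of M.  Subtracting the hypothesis on B from the equation
   for H shows that H - p C'HC - q (HC^2 + C'^2 H) is positive definite.  At an
   eigenvector x of C for lambda, its quadratic form is
   (1 - p |lambda|^2 - 2 q Re(lambda^2)) x'Hx, and the first factor equals
   1 - (Re lambda)^2 / a^2 - (Im lambda)^2 / b^2. *)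
Require Import Defs.
From mathcomp Require Import ring.

Set Implicit Arguments.
Unset Strict Implicit.
Unset Printing Implicit Defensive.

(* [eigenvalue] is defined through row eigenvectors. *)
Lemma eigenvalue_cV (F : fieldType) (n : nat) (M : 'M[F]_n) (l : F) :
  eigenvalue M l -> exists2 x : 'cV[F]_n, x != 0 & M *m x = l *: x.
Proof.
rewrite /eigenvalue /eigenspace kermx_eq0 -row_leq_rank -ltnNge -mxrank_tr => lt_rk.
(* Transposition preserves rank, so [(M - l%:M)^T] is singular too; a row of its kernel, transposed,
   is a column eigenvector. *)
have: kermx (M - l%:M)^T != 0 by rewrite kermx_eq0 -row_leq_rank -ltnNge.
case/rowV0Pn=> v /sub_kermxP vM v_neq0; exists v^T; first by rewrite trmx_eq0.
apply/eqP; rewrite -subr_eq0 -mul_scalar_mx -mulmxBl -trmx_eq0 trmx_mul trmxK.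
by rewrite vM.
Qed.

Lemma adjmxD (C : numClosedFieldType) (m n : nat) (M N : 'M[C]_(m, n)) :
  (M + N) ^t* = M ^t* + N ^t*.
Proof. by rewrite linearD /= map_mxD. Qed.

Lemma adjmxM (C : numClosedFieldType) (m n p : nat) (M : 'M[C]_(m, n))
    (N : 'M[C]_(n, p)) :
  (M *m N) ^t* = N ^t* *m M ^t*.
Proof. by rewrite trmx_mul map_mxM. Qed.

Lemma adjmxZ (C : numClosedFieldType) (m n : nat) (c : C) (M : 'M[C]_(m, n)) :
  (c *: M) ^t* = c^* *: M ^t*.
Proof. by rewrite linearZ /= map_mxZ. Qed.

(* As and Bs stand for the adjoints of A and B. *)
Lemma stein_perturb (K : comPzRingType) (n : nat) (p q : K)
    (A B H As Bs : 'M[K]_n) :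
  H - p *: (As *m H *m A) - q *: (H *m (A *m A) + As *m As *m H)
  - (p *: (Bs *m H *m A + As *m H *m B + Bs *m H *m B)
     + q *: (H *m (A *m B + B *m A + B *m B)
             + (Bs *m As + As *m Bs + Bs *m Bs) *m H))
  = H - p *: ((As + Bs) *m H *m (A + B))
    - q *: (H *m ((A + B) *m (A + B)) + (As + Bs) *m (As + Bs) *m H).
Proof.
have regroup (V : zmodType) (h x y u v : V) :
    h - x - y - (u + v) = h - (x + u) - (y + v).
  by rewrite !opprD -!addrA; congr (_ + (_ + _)); rewrite addrCA.
rewrite regroup -!scalerDr; congr (_ - _ *: _ - _ *: _).
  by rewrite !(mulmxDl, mulmxDr) !addrA.
rewrite addrACA -(mulmxDr H) -(mulmxDl _ _ H).
congr (_ + _); congr (_ *m _); rewrite !(mulmxDl, mulmxDr) !addrA //.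
(* Adjunction reverses products, so only on this side do the two cross terms come in swapped
   order. *)
by congr (_ + _); rewrite addrAC.
Qed.

(** Each [C] acts on [x] from the left and yields [l], each [Cs] acts on [y] from the right and
    yields [m]. With [y] and [m] kept independent of [x] and [l], no conjugation enters. *)
Lemma stein_eigen (K : comPzRingType) (n : nat) (p q l m : K)
    (C Cs H : 'M[K]_n) (x : 'cV[K]_n) (y : 'rV[K]_n) :
  C *m x = l *: x -> y *m Cs = m *: y ->
  y *m (H - p *: (Cs *m H *m C)
        - q *: (H *m (C *m C) + Cs *m Cs *m H)) *m x
  = (1 - p * (m * l) - q * (l * l + m * m)) *: (y *m H *m x).
Proof.
move=> Cx yCs; rewrite !(mulmxDr, mulmxDl, mulmxN, mulNmx).
rewrite -!scalemxAr -!scalemxAl mulmxDr mulmxDl !mulmxA.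
rewrite !yCs -!scalemxAl yCs -!scalemxAl -!(mulmxA _ C x) Cx.
rewrite -!scalemxAr -!(mulmxA _ C x) Cx -!scalemxAr.
by rewrite !scalerBl scale1r -!scalerA !scalerDl -!scalerA.
Qed.

Theorem theorem6 (R : realType) (n : nat) (a b : R) (A H B : 'M[R[i]]_n) :
  0 < b -> b < a ->
  (forall lambda : R[i],
     eigenvalue A lambda -> lambda \in ellipse_interior a b) ->
  posdefmx H ->
  H - (1 / (2 * a ^+ 2) + 1 / (2 * b ^+ 2))%:C *: (A ^t* *m H *m A)
    - (1 / (4 * a ^+ 2) - 1 / (4 * b ^+ 2))%:C
        *: (H *m A ^+ 2 + (A ^t*) ^+ 2 *m H)
    = 1%:M ->
  ltmx_posdef
    ((1 / (2 * a ^+ 2) + 1 / (2 * b ^+ 2))%:C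
       *: (B ^t* *m H *m A + A ^t* *m H *m B + B ^t* *m H *m B)
     + (1 / (4 * a ^+ 2) - 1 / (4 * b ^+ 2))%:C
       *: (H *m (A *m B + B *m A + B ^+ 2)
           + (A *m B + B *m A + B ^+ 2) ^t* *m H))
    1%:M ->
  forall lambda : R[i],
    eigenvalue (A + B) lambda -> lambda \in ellipse_interior a b.
Proof.
move=> b_gt0 b_lt_a _ [_ H_gt0] steinA [_ ltB] l /eigenvalue_cV[x x_neq0 Cx].
have a_gt0 : 0 < a by apply: lt_trans b_lt_a.
move: {ltB}(ltB x x_neq0); rewrite -steinA !expr2 -!mulmxE !adjmxD !adjmxM.
have xC : x ^t* *m (A + B) ^t* = l^* *: x ^t* by rewrite -adjmxM Cx adjmxZ.
rewrite stein_perturb -adjmxD (stein_eigen _ _ _ Cx xC) mxE.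
rewrite pmulr_lgt0 ?H_gt0 //; case: l {Cx xC} => u v.
(* With [p], [q] the two coefficients, the factor is [1 - (p + 2q) u^2 - (p - 2q) v^2], where
   [p + 2q = 1 / a^2] and [p - 2q = 1 / b^2]; its imaginary part cancels. *)
have -> : (1 - (1 / (2 * a ^+ 2) + 1 / (2 * b ^+ 2))%:C
             * ((u +i* v)^* * (u +i* v))
           - (1 / (4 * a ^+ 2) - 1 / (4 * b ^+ 2))%:C
             * ((u +i* v) * (u +i* v) + (u +i* v)^* * (u +i* v)^*))
   = (1 - (u ^+ 2 / a ^+ 2 + v ^+ 2 / b ^+ 2))%:C :> R[i].
  apply/eqP; rewrite eq_complex /=; apply/andP; split; apply/eqP;
  by field; rewrite !gt_eqF.
by rewrite ltcR subr_gt0.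
Qed.
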